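(* Assume $\mu_1>\mu_a$ for all $a\in\{2,\dots,K\}$ and $c_1,\dots,c_K>0$. The optimal proportion $\boldsymbol{w}^*=(w_1^*,\dots,w_K^* )$ is given by \[ w_a^*=\frac{c_a\,x_a(y^* )}{c_1+c_2x_2(y^* )+\cdots+c_Kx_K(y^* )},\qquad a\in\{1,\dots,K\}, \] with the convention $x_1(y)\equiv1$, where $y^*$ is the unique solution of $F_{\boldsymbol{\mu},\boldsymbol{c}}(y)=1$ for \[ F_{\boldsymbol{\mu},\boldsymbol{c}}(y)=\sum_{a=2}^K\frac{c_a\,d\!\left(\mu_1,\frac{\mu_1+x_a(y)\mu_a}{1+x_a(y)}\right)}{c_1\,d\!\left(\mu_a,\frac{\mu_1+x_a(y)\mu_a}{1+x_a(y)}\right)}. \]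
   Context: Rewards belong to a one-parameter natural exponential family parametrized by the mean; $d(\mu,\mu')$ is the KL divergence between members with means $\mu,\mu'$. $\Sigma_K$ is the probability simplex. $\boldsymbol{w}^*$ is the maximizer over $\boldsymbol{w}\in\Sigma_K$ of $\inf_{\boldsymbol{\lambda}:a^*(\boldsymbol{\lambda})\neq1}\sum_a\frac{w_a}{c_a}d(\mu_a,\lambda_a)$, where $\boldsymbol\lambda$ ranges over mean vectors of the family whose unique best arm is not arm $1$. For $\alpha\in[0,1]$, $I_\alpha(x,y)=\alpha d(x,\alpha x+(1-\alpha)y)+(1-\alpha)d(y,\alpha x+(1-\alpha)y)$; for $a\ge2$, $g_a(x)=(1+x)I_{1/(1+x)}(\mu_1,\mu_a)$, a strictly increasing bijection $[0,\infty)\to[0,d(\mu_1,\mu_a))$, and $x_a=g_a^{-1}:[0,d(\mu_1,\mu_a))\to[0,\infty)$. *)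

(* Defs.v *)
From mathcomp Require Import all_boot all_order all_algebra.
From mathcomp Require Import all_classical all_reals all_analysis.
Set Implicit Arguments. Unset Strict Implicit. Unset Printing Implicit Defensive.
Import Order.TTheory GRing.Theory Num.Theory numFieldNormedType.Exports.
Local Open Scope classical_set_scope.
Local Open Scope ring_scope.

Section ExpFamily.
Variables (R : realType) (nu : {measure set (measurableTypeR R) -> \bar R}).

Definition laplace (theta : R) : \bar R :=
  (\int[nu]_x (expR (theta * x))%:E)%E.

Definition nat_param_space : set R :=
  interior [set theta | (laplace theta < +oo)%E].

Definition log_partition (theta : R) : R := ln (fine (laplace theta)).

Definition ef_density (theta : R) (x : R) : R :=
  expR (theta * x - log_partition theta).

Definition ef_mean (theta : R) : R :=
  fine (\int[nu]_x (x * ef_density theta x)%:E)%E.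

Definition mean_space : set R := ef_mean @` nat_param_space.

Definition theta_of_mean (m : R) : R :=
  xget 0 [set theta | nat_param_space theta /\ ef_mean theta = m].

Definition ef_KL (theta theta' : R) : R :=
  fine (\int[nu]_x
          (ef_density theta x * ln (ef_density theta x / ef_density theta' x))%:E)%E.

Definition kl_mean (m m' : R) : R := ef_KL (theta_of_mean m) (theta_of_mean m').

End ExpFamily.

(* Bandit quantities.  Arms are 'I_K; arm "1" of the paper is ord0.          *)
(* d is the divergence, M the set of admissible means.                       *)
Section Bandit.
Variables (R : realType) (d : R -> R -> R) (M : set R).

Definition simplex (K : nat) : set ('I_K -> R) :=
  [set w | (forall a, 0 <= w a) /\ \sum_(a < K) w a = 1].

Definition unique_best_arm (K : nat) (lam : 'I_K -> R) (a : 'I_K) : Prop :=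
  forall b, b != a -> lam b < lam a.

Definition alt_set (n : nat) : set ('I_n.+1 -> R) :=
  [set lam | (forall a, M (lam a)) /\
             exists a, a != ord0 /\ unique_best_arm lam a].

Definition char_obj (n : nat) (mu c w : 'I_n.+1 -> R) : R :=
  inf [set \sum_(a < n.+1) (w a / c a) * d (mu a) (lam a) | lam in @alt_set n].

Definition is_optimal_proportion (n : nat) (mu c w : 'I_n.+1 -> R) : Prop :=
  simplex w /\
  forall w', simplex w' -> char_obj mu c w' <= char_obj mu c w.

Definition I_alpha (alpha x y : R) : R :=
  alpha * d x (alpha * x + (1 - alpha) * y)
  + (1 - alpha) * d y (alpha * x + (1 - alpha) * y).

Definition g_fun (mu1 mua x : R) : R := (1 + x) * I_alpha (1 / (1 + x)) mu1 mua.

(* x_a = g_a^{-1} : [0, d(mu_1, mu_a)) -> [0, +oo) *)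
Definition x_fun (mu1 mua y : R) : R :=
  xget 0 [set x | 0 <= x /\ g_fun mu1 mua x = y].

Definition x_arm (n : nat) (mu : 'I_n.+1 -> R) (a : 'I_n.+1) (y : R) : R :=
  if a == ord0 then 1 else x_fun (mu ord0) (mu a) y.

Definition mix_mean (n : nat) (mu : 'I_n.+1 -> R) (a : 'I_n.+1) (y : R) : R :=
  (mu ord0 + x_arm mu a y * mu a) / (1 + x_arm mu a y).

Definition F_fun (n : nat) (mu c : 'I_n.+1 -> R) (y : R) : R :=
  \sum_(a < n.+1 | a != ord0)
    (c a * d (mu ord0) (mix_mean mu a y)) / (c ord0 * d (mu a) (mix_mean mu a y)).

(* domain of the x_a, a >= 2 : 0 <= y < min_{a>=2} d(mu_1, mu_a) *)
Definition y_domain (n : nat) (mu : 'I_n.+1 -> R) (y : R) : Prop :=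
  0 <= y /\ forall a : 'I_n.+1, a != ord0 -> y < d (mu ord0) (mu a).

Definition w_of_y (n : nat) (mu c : 'I_n.+1 -> R) (y : R) : 'I_n.+1 -> R :=
  fun a => c a * x_arm mu a y / \sum_(b < n.+1) c b * x_arm mu b y.

End Bandit.

(* Main.v *)
Require Import Defs.
From mathcomp Require Import all_boot all_order all_algebra.
From mathcomp Require Import all_classical all_reals all_analysis.
From mathcomp Require Import measurable_realfun ring lra.
Set Implicit Arguments. Unset Strict Implicit. Unset Printing Implicit Defensive.
Import Order.TTheory GRing.Theory Num.Theory numFieldNormedType.Exports.
Local Open Scope classical_set_scope.
Local Open Scope ring_scope.

(* In the natural parameter, the divergence satisfies the three-point identity
   of Bregman divergences. Hence g_a(x) is the minimum over m of
   d(mu_1, m) + x d(mu_a, m), reached only at the mixture m_a of mu_1 and mu_a.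
   Optimality of w_of_y is a saddle point argument. On one side, every
   alternative costs at least y / S under w_of_y, where S = sum_b c_b x_b(y).
   On the other side, give the alternative that moves arms 1 and a to m_a the
   weight c_a / d(mu_a, m_a): the equation F(y) = 1 says exactly that the
   weighted sum of the costs is 1 for every w in the simplex, so no w
   guarantees more than y / S. Under an optimal w all these inequalities are
   equalities, so m_a minimizes the cost of moving arms 1 and a to a common
   mean, which fixes the ratio of w_a to w_1. *)

(** A nonnegative function with zero integral vanishes almost everywhere, so the complement of [x0]
    would be null. The exempted point is needed because the gap in the tangent inequality vanishes
    at the mean. *)
Lemma Rintegral_gt0_off_point (R : realType)
    (nu : {measure set (measurableTypeR R) -> \bar R}) (x0 : R) (g : R -> R) :
  (0 < nu (~` [set x0]))%E ->
  nu.-integrable setT (EFin \o g) ->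
  (forall x, 0 <= g x) -> (forall x, x != x0 -> 0 < g x) ->
  0 < \int[nu]_x g x.
Proof.
move=> nu0 ig g0 gpos.
rewrite lt_neqAle Rintegral_ge0// andbT eq_sym; apply/eqP => int0.
have [mg _] := integrableP _ _ _ ig.
have abs0 : (\int[nu]_x `|(EFin \o g) x| = 0)%E.
  under eq_integral do rewrite /= ger0_norm//.
  by rewrite -[LHS]fineK ?integrable_fin_num//; congr EFin.
have [N [mN N0 sN]] := (ae_eq_integral_abs nu measurableT mg).1 abs0.
have : (nu (~` [set x0]) <= nu N)%E.
  apply: le_measure; rewrite ?inE//; first exact: measurableC.
  move=> x /= xx0; apply: sN => /= /(_ I) [] gx0.
  by move/eqP/gpos : xx0; rewrite gx0 ltxx.
by rewrite leNgt N0 nu0.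
Qed.

Lemma measurable_expM (R : realType) (t : R) :
  measurable_fun setT (fun x : measurableTypeR R => expR (t * x)).
Proof. by apply: measurableT_comp => //; exact: measurable_funM. Qed.

(** * The exponential family in its natural parameter *)

Section natural_parameter.
Context {R : realType} {nu : {measure set (measurableTypeR R) -> \bar R}}.
Let Theta := nat_param_space nu.

Let integrable_exp_of_lt t : (laplace nu t < +oo)%E ->
  nu.-integrable setT (EFin \o (fun x => expR (t * x))).
Proof.
move=> tfin; apply/integrableP; split.
  apply/measurable_EFinP; exact: measurable_expM.
by under eq_integral do rewrite /= ger0_norm ?expR_ge0//.
Qed.

Lemma nat_param_space_open : open Theta.
Proof. exact: open_interior. Qed.

(** The inequality on [s] is non-strict so that the end points [t - e] and [t + e] can be used as
    parameters themselves. *)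
Lemma nat_param_ball t : Theta t ->
  exists2 e : R, 0 < e & forall s, `|s - t| <= e -> Theta s.
Proof.
move=> tT.
have /nbhs_ballP[e /= e0 bt] := open_nbhs_nbhs (conj nat_param_space_open tT).
exists (e / 2); first by rewrite divr_gt0.
move=> s st; apply: bt; rewrite /ball/= distrC (le_lt_trans st)//.
by rewrite ltr_pdivrMr// ltr_pMr// ltr1n.
Qed.

Lemma integrable_exp t : Theta t ->
  nu.-integrable setT (EFin \o (fun x => expR (t * x))).
Proof. by move=> /interior_subset tfin; exact: integrable_exp_of_lt. Qed.

(** For [s] between [a] and [b], exp(sx) is at most exp(ax) + exp(bx), according to the sign of x.
    The Laplace transform is then finite on the open interval from [a] to [b], which therefore lies
    in the interior. *)
Lemma is_interval_nat_param : is_interval Theta.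
Proof.
move=> a b ta tb t /andP[at_ tb_].
have [->|nta] := eqVneq t a; first exact: ta.
have [->|ntb] := eqVneq t b; first exact: tb.
have tab : t \in `]a, b[ by rewrite in_itv/= !lt_neqAle at_ tb_ ntb eq_sym nta.
have : `]a, b[%classic `<=` Theta; last exact.
rewrite -open_subsetE; last exact: itv_open.
move=> s /=; rewrite in_itv/= => /andP[as_ sb].
have : nu.-integrable setT (EFin \o (fun x => expR (s * x))).
  have iab : nu.-integrable setT
      (EFin \o (fun x => expR (a * x) + expR (b * x))).
    exact: (integrableD measurableT (integrable_exp ta) (integrable_exp tb)).
  apply: (le_integrable measurableT _ _ iab).
    by apply/measurable_EFinP; exact: measurable_expM.
  move=> x _ /=; rewrite lee_fin !ger0_norm ?addr_ge0 ?expR_ge0//.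
  have [x0|x0] := leP 0 x.
  - rewrite (@le_trans _ _ (expR (b * x))) ?lerDr ?expR_ge0//.
    by rewrite ler_expR ler_wpM2r// ltW.
  - rewrite (@le_trans _ _ (expR (a * x))) ?lerDl ?expR_ge0//.
    by rewrite ler_expR ler_wnM2r// ltW.
move=> /integrableP[_]; apply: le_lt_trans; rewrite le_eqVlt; apply/orP; left.
by apply/eqP/eq_integral => x _; rewrite /= ger0_norm ?expR_ge0.
Qed.

(* Near [t], both families are dominated by the exponentials at [t - 2e] and
   [t + 2e]: the factor |x| is absorbed by e|x| <= exp(e|x|). *)
Let dominated (t e s x : R) : 0 < e -> `|s - t| <= e ->
  expR (s * x) <= expR ((t - 2 * e) * x) + expR ((t + 2 * e) * x) /\
  `|x * expR (s * x)| <=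
    e^-1 * (expR ((t - 2 * e) * x) + expR ((t + 2 * e) * x)).
Proof.
move=> e0 st.
have key : expR (e * `|x|) * expR (s * x) <=
    expR ((t - 2 * e) * x) + expR ((t + 2 * e) * x).
  rewrite -expRD.
  have sx : (s - t) * x <= e * `|x|.
    by rewrite (le_trans (ler_norm _))// normrM ler_wpM2r.
  have [x0|x0] := leP 0 x.
  - rewrite (@le_trans _ _ (expR ((t + 2 * e) * x))) ?lerDr ?expR_ge0//.
    rewrite ler_expR; move: sx; rewrite ger0_norm//; lra.
  - rewrite (@le_trans _ _ (expR ((t - 2 * e) * x))) ?lerDl ?expR_ge0//.
    rewrite ler_expR; move: sx; rewrite ltr0_norm//; lra.
split.
  by apply: le_trans key; rewrite ler_peMl ?expR_ge0// -[leLHS]expR0 ler_expR mulr_ge0// ltW.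
rewrite normrM [X in _ * X]ger0_norm ?expR_ge0//.
rewrite -ler_pdivrMl ?invr_gt0// invrK mulrA.
apply: le_trans key; rewrite ler_wpM2r ?expR_ge0//.
by rewrite (le_trans _ (expR_ge1Dx _))// lerDr.
Qed.

(** A single integrable envelope, uniform near [t], allows limits to be taken under both integrals
    below. *)
Lemma exp_domination {t} : Theta t -> exists e (g : R -> R), [/\ 0 < e,
  nu.-integrable setT (EFin \o g),
  forall s, `]t - e, t + e[%classic s -> Theta s &
  forall s x, `]t - e, t + e[%classic s ->
    expR (s * x) <= g x /\ `|x * expR (s * x)| <= g x].
Proof.
move=> /nat_param_ball[e' e'0 te'].
(* Halving keeps the parameters t - 2e and t + 2e of the dominating exponentials inside [Theta]. *)
pose e := e' / 2; have e0 : 0 < e by rewrite divr_gt0.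
have e'E : e' = 2 * e by rewrite /e; field.
pose h x := expR ((t - 2 * e) * x) + expR ((t + 2 * e) * x).
have ih : nu.-integrable setT (EFin \o h).
  have t1 : Theta (t - 2 * e).
    by apply: te'; rewrite addrAC subrr sub0r normrN -e'E gtr0_norm.
  have t2 : Theta (t + 2 * e).
    by apply: te'; rewrite addrAC subrr add0r -e'E gtr0_norm.
  exact: (integrableD measurableT (integrable_exp t1) (integrable_exp t2)).
have h0 x : 0 <= h x by rewrite addr_ge0 ?expR_ge0.
(* The two bounds of [dominated] are [h] and [e^-1 * h]; their sum serves for both. *)
exists e, (fun x => (1 + e^-1) * h x); split => //.
- exact: (integrableZl measurableT _ ih).
- move=> s; rewrite /= in_itv/= => /andP[s1 s2]; apply: te'.
  by rewrite ler_norml; apply/andP; split; lra.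
- move=> s x; rewrite /= in_itv/= => /andP[s1 s2].
  have st : `|s - t| <= e by rewrite ler_norml; apply/andP; split; lra.
  have [d1 d2] := dominated x e0 st; rewrite mulrDl mul1r.
  have ei0 : 0 <= e^-1 by rewrite invr_ge0 ltW.
  by split; [apply: (le_trans d1)|apply: (le_trans d2)];
    rewrite ?lerDl ?lerDr// mulr_ge0.
Qed.

Lemma integrable_id_exp t : Theta t ->
  nu.-integrable setT (EFin \o (fun x => x * expR (t * x))).
Proof.
move=> /exp_domination[e [g [e0 ig _ dom]]].
apply: (le_integrable measurableT _ _ ig) => [|x _ /=].
  apply/measurable_EFinP/measurable_funM => //; exact: measurable_expM.
rewrite lee_fin; have /dom : `]t - e, t + e[%classic t.
  by rewrite /= in_itv/= ltrBlDr ltrDl e0.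
by move=> /(_ x)[_ /le_trans->//]; exact: ler_norm.
Qed.

Definition partition_function (t : R) : R := \int[nu]_x expR (t * x).
(** Formally the derivative of the partition function, which makes the mean a logarithmic
    derivative. *)
Definition moment_function (t : R) : R := \int[nu]_x (x * expR (t * x)).

Lemma continuous_partition_function t : Theta t ->
  {for t, continuous partition_function}.
Proof.
move=> tT; have [e [g [e0 ig sub dom]]] := exp_domination tT.
apply: (@continuity_under_integral _ _ _ nu (fun s x => expR (s * x)) setT
  measurableT (t - e) (t + e) _ _ g) => //.
- by move=> s /sub; exact: integrable_exp.
- apply: aeW => x _ s _; apply: continuous_comp; last exact: continuous_expR.
  exact: mulrr_continuous.
- move=> s st; apply: aeW => x _; rewrite ger0_norm ?expR_ge0//.
  by case: (dom s x st).
- by rewrite inE /= in_itv/= ltrBlDr ltrDl e0.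
Qed.

Lemma continuous_moment_function t : Theta t ->
  {for t, continuous moment_function}.
Proof.
move=> tT; have [e [g [e0 ig sub dom]]] := exp_domination tT.
apply: (@continuity_under_integral _ _ _ nu (fun s x => x * expR (s * x)) setT
  measurableT (t - e) (t + e) _ _ g) => //.
- by move=> s /sub; exact: integrable_id_exp.
- apply: aeW => x _ s _.
  have : {for s, continuous (fun r : R => (x : R) * expR (r * (x : R)))}.
    apply: continuousM; first exact: cst_continuous.
    apply: continuous_comp; last exact: continuous_expR.
    exact: mulrr_continuous.
  exact.
- by move=> s st; apply: aeW => x _; case: (dom s x st).
- by rewrite inE /= in_itv/= ltrBlDr ltrDl e0.
Qed.

Hypothesis nu_gt0 : forall x0 : R, (0 < nu (~` [set x0]))%E.

Lemma partition_function_gt0 t : Theta t -> 0 < partition_function t.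
Proof.
move=> tT; apply: (Rintegral_gt0_off_point (nu_gt0 0)).
- exact: integrable_exp.
- by move=> x; exact: expR_ge0.
- by move=> x _; exact: expR_gt0.
Qed.

Lemma log_partitionE t : log_partition nu t = ln (partition_function t).
Proof. by []. Qed.

Lemma ef_densityE t x : Theta t ->
  ef_density nu t x = expR (t * x) / partition_function t.
Proof.
move=> tT; rewrite /ef_density log_partitionE expRD expRN lnK//.
by rewrite posrE partition_function_gt0.
Qed.

Lemma ef_meanE t : Theta t ->
  ef_mean nu t = moment_function t / partition_function t.
Proof.
move=> tT; rewrite /moment_function -RintegralZr//; last exact: integrable_id_exp.
by apply: eq_Rintegral => x _; rewrite ef_densityE// mulrA.
Qed.

Lemma continuous_log_partition t : Theta t ->
  {for t, continuous (log_partition nu)}.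
Proof.
move=> tT; apply: continuous_comp; first exact: continuous_partition_function.
exact/continuous_ln/partition_function_gt0.
Qed.

Lemma continuous_ef_mean t : Theta t -> {for t, continuous (ef_mean nu)}.
Proof.
move=> tT.
have tnear : \forall s \near t, Theta s.
  exact: open_nbhs_nbhs (conj nat_param_space_open tT).
rewrite /prop_for/= /continuous_at ef_meanE//.
apply: (@cvg_trans _ ((fun s => moment_function s / partition_function s) @ t)).
  apply: near_eq_cvg; near=> s; rewrite ef_meanE//; near: s; exact: tnear.
have cL := continuous_partition_function tT.
have L0 : partition_function t != 0 by rewrite gt_eqF// partition_function_gt0.
exact: (cvgM (continuous_moment_function tT) (cvgV L0 cL)).
Unshelve. all: end_near. Qed.

(* Integrate exp(u) > 1 + u with u = (s - t)(x - ef_mean t): the linear term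
   vanishes by definition of the mean. *)
Lemma log_partition_tangent t s : Theta t -> Theta s -> s != t ->
  (s - t) * ef_mean nu t < log_partition nu s - log_partition nu t.
Proof.
move=> tT sT st; set m := ef_mean nu t; pose h := s - t.
have L0 := partition_function_gt0 tT; have Ls0 := partition_function_gt0 sT.
pose a := expR (h * m).
pose q x := a * ((1 - h * m) * expR (t * x) + h * (x * expR (t * x))).
have expE x : expR (s * x) = a * expR (t * x) * expR (h * (x - m)).
  by rewrite /a -!expRD; congr expR; rewrite /h; ring.
have qE x : q x = a * expR (t * x) * (1 + h * (x - m)) by rewrite /q; ring.
have i1 : nu.-integrable setT (EFin \o (fun x => (1 - h * m) * expR (t * x))).
  exact: (integrableZl measurableT _ (integrable_exp tT)).
have i2 : nu.-integrable setT (EFin \o (fun x => h * (x * expR (t * x)))).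
  exact: (integrableZl measurableT _ (integrable_id_exp tT)).
have i3 : nu.-integrable setT (EFin \o
    (fun x => (1 - h * m) * expR (t * x) + h * (x * expR (t * x)))).
  exact: (integrableD measurableT i1 i2).
have iq : nu.-integrable setT (EFin \o q) by exact: (integrableZl measurableT _ i3).
have intq : \int[nu]_x q x = a * partition_function t.
  rewrite (RintegralZl a measurableT i3) (RintegralD measurableT i1 i2).
  rewrite (RintegralZl _ measurableT (integrable_exp tT)).
  rewrite (RintegralZl _ measurableT (integrable_id_exp tT)).
  rewrite -/(moment_function t) -/(partition_function t).
  have -> : moment_function t = m * partition_function t.
    by rewrite /m (ef_meanE tT) (divfK (lt0r_neq0 L0)).
  move: (partition_function t) => L; by congr (_ * _); ring.
have : 0 < \int[nu]_x (expR (s * x) - q x).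
  apply: (Rintegral_gt0_off_point (nu_gt0 m)).
  - exact: (integrableB measurableT (integrable_exp sT) iq).
  - move=> x; rewrite expE qE -mulrBr mulr_ge0 ?mulr_ge0 ?expR_ge0//.
    by rewrite subr_ge0 expR_ge1Dx.
  - move=> x xm; rewrite expE qE -mulrBr mulr_gt0 ?mulr_gt0 ?expR_gt0//.
    by rewrite subr_gt0 expR_gt1Dx// mulf_neq0// subr_eq0.
rewrite (RintegralB measurableT (integrable_exp sT) iq).
rewrite intq subr_gt0 -/(partition_function s) => lt_aL.
rewrite !log_partitionE; move: L0 Ls0 lt_aL; rewrite /a.
move: (partition_function t) (partition_function s) => Lt Ls Lt0 Ls0 lt_aL.
by rewrite ltrBrDr -ltr_expR expRD !lnK ?posrE.
Qed.

(** Adding the strict tangent inequalities at [t] and at [s] cancels the log-partition terms. *)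
Lemma ef_mean_lt t s : Theta t -> Theta s -> t < s -> ef_mean nu t < ef_mean nu s.
Proof.
move=> tT sT ts.
have h1 := log_partition_tangent tT sT (negbT (gt_eqF ts)).
have h2 := log_partition_tangent sT tT (negbT (lt_eqF ts)).
move: h1 h2; move: (ef_mean nu t) (ef_mean nu s) (log_partition nu t).
move: (log_partition nu s) => As mt ms At h1 h2.
have : 0 < (s - t) * (ms - mt) by lra.
by rewrite pmulr_rgt0 ?subr_gt0.
Qed.

(** The log-likelihood ratio is affine in x, so integrating it only involves the mean. The result is
    the Bregman divergence of the log-partition function, with its arguments exchanged. *)
Lemma ef_KLE t s : Theta t -> Theta s -> ef_KL nu t s =
  log_partition nu s - log_partition nu t - (s - t) * ef_mean nu t.
Proof.
move=> tT sT; have L0 := partition_function_gt0 tT.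
set b := log_partition nu s - log_partition nu t.
have i1 := integrable_exp tT; have i2 := integrable_id_exp tT.
pose r := (partition_function t)^-1.
have j1 : nu.-integrable setT (EFin \o (fun x => b * r * expR (t * x))).
  exact: (integrableZl measurableT _ i1).
have j2 : nu.-integrable setT (EFin \o (fun x => (s - t) * r * (x * expR (t * x)))).
  exact: (integrableZl measurableT _ i2).
transitivity (\int[nu]_x (b * r * expR (t * x) - (s - t) * r * (x * expR (t * x)))).
  apply: eq_Rintegral => x _.
  have -> : ln (ef_density nu t x / ef_density nu s x) = b - (s - t) * x.
    rewrite /ef_density -expRN -expRD expRK /b.
    by move: (log_partition nu t) (log_partition nu s) => At As; ring.
  by rewrite (ef_densityE _ tT) /r => {j1 j2}; move: (_^-1) b => q b'; ring.
rewrite (RintegralB measurableT j1 j2) (RintegralZl _ measurableT i1).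
rewrite (RintegralZl _ measurableT i2) (ef_meanE tT).
rewrite -/(moment_function t) -/(partition_function t) /r => {i1 i2 j1 j2}.
move: (partition_function t) (moment_function t) b L0 => L N b' L0.
by field; rewrite gt_eqF.
Qed.

End natural_parameter.

(* [th] is the dual coordinate: for an exponential family it sends a mean to
   its natural parameter. *)
Record bregman_divergence (R : realType) (d : R -> R -> R) (M : set R)
    (th : R -> R) : Prop := BregmanDivergence {
  bregman_open : open M;
  bregman_interval : is_interval M;
  bregman_id : forall x, M x -> d x x = 0;
  bregman_gt0 : forall x y, M x -> M y -> x != y -> 0 < d x y;
  bregman_dual_le : forall x y, M x -> M y -> x <= y -> th x <= th y;
  bregman_three_point : forall x y z, M x -> M y -> M z ->
    d x z = d x y + d y z + (th z - th y) * (y - x);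
  bregman_continuous : forall x y, M x -> M y -> {for y, continuous (d x)} }.

(** * Bregman divergences and the cost of moving two arms to a common mean *)

Section two_arms.
Context {R : realType} {d : R -> R -> R} {M : set R} {th : R -> R}.
Hypothesis dM : bregman_divergence d M th.

Lemma bregman_ge0 x y : M x -> M y -> 0 <= d x y.
Proof.
move=> Mx My; have [->|xy] := eqVneq x y; first by rewrite (bregman_id dM).
exact/ltW/(bregman_gt0 dM).
Qed.

Lemma bregman_eq0 x y : M x -> M y -> d x y = 0 -> x = y.
Proof.
move=> Mx My /eqP; apply: contraTeq => xy.
by rewrite gt_eqF// (bregman_gt0 dM).
Qed.

(** The segment from [x] towards [y], parametrized by the ratio [t] of the two weights; [mix_mean]
    is convertible to an instance of it. *)
Definition mixture (x y t : R) := (x + t * y) / (1 + t).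

Lemma mixture_bound (x y t : R) : y < x -> 0 <= t -> y < mixture x y t <= x.
Proof.
move=> yx t0; have t1 : 0 < 1 + t by rewrite ltr_pwDl.
rewrite /mixture ltr_pdivlMr// ler_pdivrMr// -subr_gt0 -[X in _ && X]subr_ge0.
have -> : x + t * y - y * (1 + t) = x - y by ring.
have -> : x * (1 + t) - (x + t * y) = t * (x - y) by ring.
by rewrite subr_gt0 yx mulr_ge0// subr_ge0 ltW.
Qed.

Lemma mixture_in (x y t : R) : M x -> M y -> y < x -> 0 <= t -> M (mixture x y t).
Proof.
move=> Mx My yx t0; have /andP[h1 h2] := mixture_bound yx t0.
by apply: (bregman_interval dM My Mx); rewrite (ltW h1).
Qed.

(** The barycentre equation: it cancels linear terms when three-point identities at [x] and [y] are
    added with weights 1 and [t]. *)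
Lemma mixture_balance (x y t : R) : 0 <= t ->
  x - mixture x y t = t * (mixture x y t - y).
Proof. by move=> t0; rewrite /mixture; field; rewrite gt_eqF// ltr_pwDl. Qed.

Lemma mixture_surj (x y z : R) : y < z <= x -> exists2 t, 0 <= t & mixture x y t = z.
Proof.
move=> /andP[yz zx]; have zy0 : z - y != 0 by rewrite subr_eq0 gt_eqF.
exists ((x - z) / (z - y)); first by rewrite divr_ge0 ?subr_ge0// ltW.
have xy0 : x - y != 0 by rewrite subr_eq0 gt_eqF// (lt_le_trans yz).
rewrite /mixture; field; rewrite zy0 /=.
by have -> : z - y + (x - z) = x - y by ring.
Qed.

Lemma g_funE (x y t : R) : 0 <= t -> g_fun d x y t =
  d x (mixture x y t) + t * d y (mixture x y t).
Proof.
move=> t0; have t1 : 1 + t != 0 by rewrite gt_eqF// ltr_pwDl.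
rewrite /g_fun /I_alpha.
have -> : 1 / (1 + t) * x + (1 - 1 / (1 + t)) * y = mixture x y t.
  by rewrite /mixture; field.
by move: (d x _) (d y _) => p q; field.
Qed.

(** Expand both divergences at the mixture m. By the barycentre equation the linear terms add up to
    (th v - th u) t (m - y), which is nonnegative because [th] is monotone. Alternatives are the
    case where [u] and [v] are the new means of arms 1 and a. *)
Lemma g_fun_two_points x y t u v : M x -> M y -> y < x -> 0 <= t ->
  M u -> M v -> u <= v -> g_fun d x y t <= d x u + t * d y v.
Proof.
move=> Mx My yx t0 Mu Mv uv; rewrite g_funE//; set m := mixture x y t.
have Mm : M m by exact: mixture_in.
rewrite (bregman_three_point dM Mx Mm Mu) (bregman_three_point dM My Mm Mv).
have bal := mixture_balance x y t0; rewrite -/m in bal.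
have /andP[ym _] := mixture_bound yx t0; rewrite -/m in ym.
have h1 : 0 <= d m u by exact: bregman_ge0.
have h2 : 0 <= t * d m v by rewrite mulr_ge0// bregman_ge0.
have h3 : 0 <= (th v - th u) * (t * (m - y)).
  rewrite mulr_ge0 ?subr_ge0 ?(bregman_dual_le dM)// mulr_ge0// subr_ge0.
  exact: ltW.
have e : (th u - th m) * (m - x) = - ((th u - th m) * (t * (m - y))).
  by rewrite -bal; ring.
rewrite e; move: h1 h2 h3.
move: (d m u) (d m v) (d x m) (d y m) => *; lra.
Qed.

(** With a common target the linear terms cancel exactly, and the excess over the minimum is a
    divergence from the mixture. *)
Lemma compensation x y t z : M x -> M y -> y < x -> 0 <= t -> M z ->
  d x z + t * d y z = g_fun d x y t + (1 + t) * d (mixture x y t) z.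
Proof.
move=> Mx My yx t0 Mz; rewrite g_funE//; set m := mixture x y t.
have Mm : M m by exact: mixture_in.
rewrite (bregman_three_point dM Mx Mm Mz) (bregman_three_point dM My Mm Mz).
have bal := mixture_balance x y t0; rewrite -/m in bal.
have -> : (th z - th m) * (m - x) = - ((th z - th m) * (t * (m - y))).
  by rewrite -bal; ring.
ring.
Qed.

(** Compare [m] with the barycentre b of [x] and [y]. Expanding at b, the cost at [m] exceeds that
    at b by (u + v) d(b, m), so minimality forces m = b. When u + v = 0, both weights vanish. *)
Lemma weighted_mean_of_minimizer (x y u v m : R) : M x -> M y -> M m ->
  0 <= u -> 0 <= v ->
  (forall z, M z -> u * d x m + v * d y m <= u * d x z + v * d y z) ->
  u * (x - m) + v * (y - m) = 0.
Proof.
move=> Mx My Mm u0 v0 mmin.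
have [uv0|uv0] := eqVneq (u + v) 0.
  have -> : u = 0 by lra.
  have -> : v = 0 by lra.
  by rewrite !mul0r addr0.
have uv_gt0 : 0 < u + v by rewrite lt_neqAle eq_sym uv0 addr_ge0.
pose b := (u * x + v * y) / (u + v).
have bE : b * (u + v) = u * x + v * y by rewrite /b divfK.
have Mb : M b.
  have [yx|xy] := leP y x.
  - apply: (bregman_interval dM My Mx).
    rewrite /b ler_pdivlMr// ler_pdivrMr//; apply/andP; split; nra.
  - apply: (bregman_interval dM Mx My).
    rewrite /b ler_pdivlMr// ler_pdivrMr//; apply/andP; split; nra.
have := mmin b Mb.
rewrite (bregman_three_point dM Mx Mb Mm) (bregman_three_point dM My Mb Mm).
rewrite -subr_ge0 (_ : _ - _ =
    - ((u + v) * d b m) - (th m - th b) * (b * (u + v) - (u * x + v * y)));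
  last by ring.
rewrite bE subrr mulr0 subr0 oppr_ge0 pmulr_rle0// => dbm.
have <- : b = m by apply: bregman_eq0 => //; apply/le_anti; rewrite dbm bregman_ge0.
have -> : u * (x - b) + v * (y - b) = u * x + v * y - b * (u + v) by ring.
by rewrite bE subrr.
Qed.

Lemma g_fun_lt_bound (x y t : R) : M x -> M y -> y < x -> 0 <= t ->
  g_fun d x y t < d x y.
Proof.
move=> Mx My yx t0; have := compensation Mx My yx t0 My.
rewrite (bregman_id dM)// mulr0 addr0 => ->.
rewrite ltrDl mulr_gt0//; first by rewrite ltr_pwDl.
apply: (bregman_gt0 dM) => //; first exact: mixture_in.
by have /andP[/gt_eqF->] := mixture_bound yx t0.
Qed.

Lemma g_fun0 x y : M x -> g_fun d x y 0 = 0.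
Proof.
move=> Mx; rewrite g_funE// /mixture !mul0r !addr0 divr1.
exact: (bregman_id dM).
Qed.

Lemma g_fun_lt (x y s t : R) : M x -> M y -> y < x -> 0 <= s -> s < t ->
  g_fun d x y s < g_fun d x y t.
Proof.
move=> Mx My yx s0 st; have t0 : 0 <= t by exact: ltW (le_lt_trans s0 st).
have Mm : M (mixture x y t) by exact: mixture_in.
(* The minimizer for [t] is a test point for [s], where it is charged the smaller weight. *)
apply: (le_lt_trans (g_fun_two_points Mx My yx s0 Mm Mm (lexx _))).
rewrite [ltRHS]g_funE// ltrD2l ltr_pM2r//.
apply: (bregman_gt0 dM) => //.
by have /andP[/lt_eqF->] := mixture_bound yx t0.
Qed.

Lemma g_fun_le (x y s t : R) : M x -> M y -> y < x -> 0 <= s -> s <= t ->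
  g_fun d x y s <= g_fun d x y t.
Proof.
move=> Mx My yx s0; rewrite le_eqVlt => /predU1P[->//|st].
exact/ltW/g_fun_lt.
Qed.

Lemma g_fun_inj (x y s t : R) : M x -> M y -> y < x -> 0 <= s -> 0 <= t ->
  g_fun d x y s = g_fun d x y t -> s = t.
Proof.
move=> Mx My yx s0 t0 e; case: (ltgtP s t) => // st.
- by have := g_fun_lt Mx My yx s0 st; rewrite e ltxx.
- by have := g_fun_lt Mx My yx t0 st; rewrite e ltxx.
Qed.

Lemma continuous_mixture (x y t : R) : 0 <= t -> {for t, continuous (mixture x y)}.
Proof.
move=> t0; rewrite /prop_for /continuous_at /mixture.
apply: cvgM.
  apply: cvgD; first exact: cvg_cst.
  by apply: cvgM; [exact: cvg_id|exact: cvg_cst].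
apply: cvgV; first by rewrite gt_eqF// ltr_pwDl.
by apply: cvgD; [exact: cvg_cst|exact: cvg_id].
Qed.

Lemma continuous_bregman_mixture z x y t : M z -> M x -> M y -> y < x -> 0 <= t ->
  {for t, continuous (fun t => d z (mixture x y t))}.
Proof.
move=> Mz Mx My yx t0; apply: continuous_comp; first exact: continuous_mixture.
by apply: (bregman_continuous dM) => //; exact: mixture_in.
Qed.

(** An intermediate value argument. The level [v] is exceeded somewhere because d(x, z) tends to
    d(x, y) > v as z decreases to [y], and every such z is a mixture. *)
Lemma g_fun_surj (x y v : R) : M x -> M y -> y < x -> 0 <= v < d x y ->
  exists2 t, 0 <= t & g_fun d x y t = v.
Proof.
move=> Mx My yx /andP[v0 vd].
pose h t := d x (mixture x y t) + t * d y (mixture x y t).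
have [T T0 vT] : exists2 T, 0 <= T & v <= h T.
  have c : d x z @[z --> y^'+] --> d x y.
    by apply: cvg_at_right_filter; exact: (bregman_continuous dM).
  near y^'+ => z.
  have vz : v < d x z by near: z; exact: cvgr_gt vd.
  have yz : y < z by near: z; exact: nbhs_right_gt.
  have zx : z < x by near: z; exact: nbhs_right_lt.
  have [|t t0 tz] := @mixture_surj x y z; first by rewrite yz ltW.
  exists t => //; rewrite /h tz (le_trans (ltW vz))// lerDl mulr_ge0// bregman_ge0//.
  by rewrite -tz; exact: mixture_in.
have ch : {within `[0, T], continuous h}.
  apply: continuous_in_subspaceT => t; rewrite inE/= in_itv/= => /andP[t0 _].
  apply: cvgD; first exact: continuous_bregman_mixture.
  by apply: cvgM; [exact: cvg_id|exact: continuous_bregman_mixture].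
have h0 : h 0 = 0 by rewrite /h -(g_funE _ _ (lexx 0)) g_fun0.
have vh : Num.min (h 0) (h T) <= v <= Num.max (h 0) (h T).
  by rewrite h0 ge_min le_max v0 vT orbT.
have [t tT ht] := IVT T0 ch vh.
move: tT; rewrite in_itv/= => /andP[t0 _].
by exists t => //; rewrite g_funE//.
Unshelve. all: end_near. Qed.

Lemma x_funP (x y v : R) : M x -> M y -> y < x -> 0 <= v < d x y ->
  0 <= x_fun d x y v /\ g_fun d x y (x_fun d x y v) = v.
Proof.
move=> Mx My yx /(g_fun_surj Mx My yx)[t t0 gt].
by rewrite /x_fun; case: xgetP => [z _ //|/(_ t)[]].
Qed.

Lemma g_funK (x y t : R) : M x -> M y -> y < x -> 0 <= t ->
  x_fun d x y (g_fun d x y t) = t.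
Proof.
move=> Mx My yx t0.
have [|h1 h2] := x_funP (v := g_fun d x y t) Mx My yx; last exact: g_fun_inj h2.
by rewrite g_fun_lt_bound// -(g_fun0 y Mx) g_fun_le.
Qed.

(** No preimage exists, so [xget] returns its default 0. As this is also the value at level 0,
    [x_fun] is continuous there from both sides. *)
Lemma x_fun_lt0 (x y v : R) : M x -> M y -> y < x -> v < 0 -> x_fun d x y v = 0.
Proof.
move=> Mx My yx v0; rewrite /x_fun; case: xgetP => // t _ [t0 gt].
by have := g_fun_le Mx My yx (lexx _) t0; rewrite g_fun0// gt leNgt v0.
Qed.

Lemma x_fun_ge0 (x y v : R) : 0 <= x_fun d x y v.
Proof. by rewrite /x_fun; case: xgetP => // t _ []. Qed.

(** Levels between g(t - e) and g(t + e) have their preimage within [e] of [t], by monotonicity. If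
    t - e is negative, the lower bound holds for free. *)
Lemma continuous_x_fun (x y v : R) : M x -> M y -> y < x -> 0 <= v < d x y ->
  {for v, continuous (x_fun d x y)}.
Proof.
move=> Mx My yx vd; have [t0 gt] := x_funP Mx My yx vd.
have /andP[v0 vd'] := vd.
set t := x_fun d x y v in t0 gt *.
apply/cvgrPdist_lt => e e0.
have tlo : \forall u \near v,
    t - e < 0 \/ (0 <= t - e /\ g_fun d x y (t - e) < u).
  have [te|te] := ltP (t - e) 0; first by near=> u; left.
  near=> u; right; split => //; near: u; apply: lt_nbhsr.
  by rewrite -[ltRHS]gt g_fun_lt// ltrBlDr ltrDl.
near=> u.
have ud : u < d x y by near: u; exact: lt_nbhsl.
have up : u < g_fun d x y (t + e).
  near: u; apply: lt_nbhsl; rewrite -[ltLHS]gt g_fun_lt// ltrDl//.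
have lo : t - e < 0 \/ (0 <= t - e /\ g_fun d x y (t - e) < u) by near: u.
rewrite distrC ltr_distl -/t.
have [u0|u0] := ltP u 0.
  rewrite x_fun_lt0// ltr_wpDl// andbT; case: lo => [//|[te gu]].
  by have := g_fun_le Mx My yx (lexx _) te; rewrite g_fun0// leNgt (lt_trans gu).
have [|s0 gs] := x_funP (v := u) Mx My yx; first by rewrite u0.
have te0 : 0 <= t + e by rewrite addr_ge0// ltW.
apply/andP; split.
  case: lo => [te|[te gu]]; first exact: lt_le_trans te s0.
  rewrite ltNge; apply/negP => h.
  by have := g_fun_le Mx My yx s0 h; rewrite gs leNgt gu.
rewrite ltNge; apply/negP => h.
by have := g_fun_le Mx My yx te0 h; rewrite gs leNgt up.
Unshelve. all: end_near. Qed.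

End two_arms.

(** * Bounds on the value of a proportion *)

Section bandit.
Context {R : realType} {d : R -> R -> R} {M : set R} {th : R -> R}.
Hypothesis dM : bregman_divergence d M th.
Context {n : nat} {mu c : 'I_n.+1 -> R}.
Hypothesis n_gt0 : (0 < n)%N.
Hypothesis mu_in : forall a, M (mu a).
Hypothesis mu_lt : forall a : 'I_n.+1, a != ord0 -> mu a < mu ord0.
Hypothesis c_gt0 : forall a, 0 < c a.

Definition transport_cost (w lam : 'I_n.+1 -> R) : R :=
  \sum_(a < n.+1) (w a / c a) * d (mu a) (lam a).

Definition pair_cost (w : 'I_n.+1 -> R) (a : 'I_n.+1) (z : R) : R :=
  w ord0 / c ord0 * d (mu ord0) z + w a / c a * d (mu a) z.

Lemma transport_cost_ge0 w lam : (forall a, 0 <= w a) -> (forall a, M (lam a)) ->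
  0 <= transport_cost w lam.
Proof.
move=> w0 lamM; apply: sumr_ge0 => a _.
by rewrite mulr_ge0 ?divr_ge0// ?(ltW (c_gt0 _))// (bregman_ge0 dM).
Qed.

Lemma pair_le_transport_cost w lam (a : 'I_n.+1) : (forall a, 0 <= w a) ->
  (forall a, M (lam a)) -> a != ord0 ->
  w ord0 / c ord0 * d (mu ord0) (lam ord0) + w a / c a * d (mu a) (lam a) <=
  transport_cost w lam.
Proof.
move=> w0 lamM a0; rewrite /transport_cost (bigD1 ord0)//= (bigD1 a)//= addrA.
rewrite lerDl sumr_ge0// => b _.
by rewrite mulr_ge0 ?divr_ge0// ?(ltW (c_gt0 _))// (bregman_ge0 dM).
Qed.

Lemma char_obj_le w lam : (forall a, 0 <= w a) -> alt_set M lam ->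
  char_obj d M mu c w <= transport_cost w lam.
Proof.
move=> w0 lam_alt; apply: ge_inf; last by exists lam.
by exists 0 => _ [l [lM _] <-]; exact: transport_cost_ge0.
Qed.

(* A mean vector of which some arm other than [ord0] is a best arm, possibly
   tied, is a limit of alternatives: raise its best such arm. *)
Lemma char_obj_le_transport_cost w lam (a : 'I_n.+1) : (forall a, 0 <= w a) ->
  (forall a, M (lam a)) -> a != ord0 -> lam ord0 <= lam a ->
  char_obj d M mu c w <= transport_cost w lam.
Proof.
move=> w0 lamM a0 lam_a.
have [b b0 lam_b] : exists2 b, b != ord0 & forall a', lam a' <= lam b.
  have [b b0 lam_b] := @arg_maxP _ _ _ a (fun b => b != ord0) lam a0.
  exists b => // a'; have [->|] := eqVneq a' ord0; last exact: lam_b.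
  exact: le_trans lam_a (lam_b _ a0).
pose raised t b' := if b' == b then t else lam b'.
have c1 : transport_cost w (raised t) @[t --> (lam b)^'+] --> transport_cost w lam.
  have -> : transport_cost w lam = transport_cost w (raised (lam b)).
    by apply: eq_bigr => b' _; rewrite /raised; case: eqP => // ->.
  apply: cvg_at_right_filter.
  apply: (cvg_big add_continuous) => b' _; rewrite /raised; case: eqP => // _;
    last exact: cvg_cst.
  apply: cvgM; first exact: cvg_cst.
  exact: (bregman_continuous dM).
have near_in : \forall t \near lam b, M t.
  exact: open_nbhs_nbhs (conj (bregman_open dM) (lamM b)).
have nbhs_right_in : \forall t \near (lam b)^'+, M t by exact: cvg_within near_in.
apply: (cvgr_to_ge c1); near=> t.
have lt_bt : lam b < t by near: t; exact: nbhs_right_gt.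
have Mt : M t by near: t; exact: nbhs_right_in.
apply: char_obj_le => //; split.
  by move=> b'; rewrite /raised; case: eqP.
exists b; split => // b' bb'.
by rewrite /raised eqxx (negbTE bb') (le_lt_trans (lam_b b')).
Unshelve. all: end_near. Qed.

(** Arms [ord0] and [a] are tied at [z] and the other arms stay in place at no cost. If one of these
    beats [z], some arm other than [ord0] is still a best one. *)
Lemma char_obj_le_pair_cost w (a : 'I_n.+1) z : (forall a, 0 <= w a) ->
  a != ord0 -> M z -> char_obj d M mu c w <= pair_cost w a z.
Proof.
move=> w0 a0 Mz.
pose lam b := if (b == ord0) || (b == a) then z else mu b.
have -> : pair_cost w a z = transport_cost w lam.
  rewrite /transport_cost (bigD1 ord0)//= (bigD1 a)//= big1 ?addr0.
    by rewrite /lam !eqxx orbT.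
  move=> b /andP[b0 ba].
  by rewrite /lam (negbTE b0) (negbTE ba) (bregman_id dM)// mulr0.
apply: (@char_obj_le_transport_cost _ _ a) => //.
- by move=> b; rewrite /lam; case: ifP.
- by rewrite /lam !eqxx orbT.
Qed.

Lemma other_arm : exists a : 'I_n.+1, a != ord0.
Proof. by exists (Ordinal (n_gt0 : (1 < n.+1)%N)). Qed.

(** A lower bound on the elements bounds [inf] only for a nonempty set. The witness takes its values
    from [mu], so they are admissible. *)
Lemma alt_set_nonempty : alt_set M (n := n) !=set0.
Proof.
have [a a0] := other_arm.
exists (fun b => if b == a then mu ord0 else mu a); split.
  by move=> b; case: ifP.
by exists a; split => // b /negbTE ->; rewrite eqxx mu_lt.
Qed.

(** * The saddle point at a given level *)

Section at_level.
Context {y : R}.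
Hypothesis yD : y_domain d mu y.
Let x a := x_arm d mu a y.
Let m a := mix_mean d mu a y.
Let S := \sum_(b < n.+1) c b * x b.

Lemma x_arm_ge0 a : 0 <= x a.
Proof. by rewrite /x /x_arm; case: ifP => // _; exact: x_fun_ge0. Qed.

Lemma g_fun_x_arm a : a != ord0 -> g_fun d (mu ord0) (mu a) (x a) = y.
Proof.
move=> a0; rewrite /x /x_arm (negbTE a0); case: yD => y0 /(_ a a0) ya.
by apply: (x_funP dM _ _ (mu_lt a0) _).2; rewrite ?y0.
Qed.

Lemma x_arm0 : x ord0 = 1.
Proof. by rewrite /x /x_arm eqxx. Qed.

Lemma mix_mean_in a : a != ord0 -> M (m a).
Proof. by move=> a0; apply: (mixture_in dM) => //; [exact: mu_lt|exact: x_arm_ge0]. Qed.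

Lemma mix_mean_gt a : a != ord0 -> mu a < m a.
Proof.
by move=> a0; have /andP[] := mixture_bound (mu_lt a0) (x_arm_ge0 a).
Qed.

Lemma d_mix_mean_gt0 a : a != ord0 -> 0 < d (mu a) (m a).
Proof.
move=> a0; apply: (bregman_gt0 dM) => //; first exact: mix_mean_in.
by rewrite lt_eqF// mix_mean_gt.
Qed.

Lemma normalization_gt0 : 0 < S.
Proof.
rewrite /S (bigD1 ord0)//= x_arm0 mulr1 ltr_pwDl// sumr_ge0// => b _.
by rewrite mulr_ge0 ?x_arm_ge0// ltW.
Qed.

Lemma simplex_w_of_y : simplex (w_of_y d mu c y).
Proof.
have S0 := normalization_gt0; split => [a|].
  by rewrite /w_of_y divr_ge0 ?mulr_ge0 ?(ltW S0) ?x_arm_ge0 ?ltW.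
by rewrite /w_of_y -mulr_suml divff// gt_eqF.
Qed.

Lemma w_of_y_div a : w_of_y d mu c y a / c a = x a / S.
Proof.
have S0 := normalization_gt0; have ca := c_gt0 a.
rewrite /w_of_y -/(x a) -/S; field.
by rewrite !gt_eqF.
Qed.

(** The proportions equalize: every [x a] is the preimage of the same level [y], so all pairs cost
    the same. *)
Lemma pair_cost_w_of_y a : a != ord0 ->
  pair_cost (w_of_y d mu c y) a (m a) = y / S.
Proof.
move=> a0; rewrite /pair_cost !w_of_y_div x_arm0 -[in RHS](g_fun_x_arm a0).
rewrite g_funE ?x_arm_ge0// -[mixture _ _ _]/(m a).
by have := normalization_gt0; move: (d _ _) (d _ _) => p q S0; field; rewrite gt_eqF.
Qed.

(** In an alternative with best arm a, arm 1 ends below arm a. Keeping only these two arms,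
    [g_fun_two_points] bounds the cost below by g_a(x_a) / S. *)
Lemma le_char_obj_w_of_y : y / S <= char_obj d M mu c (w_of_y d mu c y).
Proof.
have S0 := normalization_gt0.
apply: lb_le_inf.
  by have [lam lam_alt] := alt_set_nonempty; eexists; exists lam.
move=> _ [lam [lamM [a [a0 best]]] <-].
have [w0 _] := simplex_w_of_y.
apply: le_trans (pair_le_transport_cost w0 lamM a0).
rewrite !w_of_y_div x_arm0.
have := g_fun_two_points dM (mu_in ord0) (mu_in a) (mu_lt a0) (x_arm_ge0 a)
  (lamM ord0) (lamM a) (ltW (best _ _)).
rewrite g_fun_x_arm// => h.
rewrite ler_pdivrMr//; apply: le_trans (h _) _; first by rewrite eq_sym.
move: (d _ _) (d _ _) => p q.
by rewrite le_eqVlt; apply/orP; left; apply/eqP; field; rewrite gt_eqF.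
Qed.

Hypothesis F1 : F_fun d mu c y = 1.

(* Optimal weights of the alternatives (mu with arms 1 and a moved to m_a) in
   the dual problem: they make the averaged cost constant on the simplex. *)
Let p a := c a / d (mu a) (m a).

Let p_gt0 a : a != ord0 -> 0 < p a.
Proof. by move=> a0; rewrite divr_gt0// d_mix_mean_gt0. Qed.

(** The coefficient of [w ord0] is F(y) = 1, and each other [w a] has coefficient 1 by the choice of
    [p]. *)
Lemma weighted_pair_costs w : simplex w ->
  \sum_(a < n.+1 | a != ord0) p a * pair_cost w a (m a) = 1.
Proof.
move=> [_ sw].
transitivity (\sum_(a < n.+1 | a != ord0) (w ord0 *
    ((c a * d (mu ord0) (m a)) / (c ord0 * d (mu a) (m a))) + w a)).
  apply: eq_bigr => a a0; rewrite /p /pair_cost.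
  have := d_mix_mean_gt0 a0; have := c_gt0 a; have := c_gt0 ord0.
  move: (d _ _) (d _ _) => q r c0 ca r0.
  by field; rewrite !gt_eqF.
rewrite big_split/= -mulr_sumr -/(F_fun d mu c y) F1 mulr1.
by rewrite -sw [RHS](bigD1 ord0).
Qed.

Lemma sum_dual_weights_gt0 : 0 < \sum_(a < n.+1 | a != ord0) p a.
Proof.
have [a a0] := other_arm; rewrite (bigD1 a)//= ltr_pwDl ?p_gt0// sumr_ge0// => b.
by move=> /andP[b0 _]; exact/ltW/p_gt0.
Qed.

(** Evaluate the constant average at [w_of_y], whose pair costs all equal y / S. *)
Lemma sum_dual_weights : (\sum_(a < n.+1 | a != ord0) p a) * (y / S) = 1.
Proof.
rewrite -(weighted_pair_costs simplex_w_of_y) mulr_suml.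
by apply: eq_bigr => a a0; rewrite pair_cost_w_of_y.
Qed.

Lemma w_of_y_optimal : is_optimal_proportion d M mu c (w_of_y d mu c y).
Proof.
split; first exact: simplex_w_of_y.
move=> w sw; apply: le_trans le_char_obj_w_of_y.
rewrite -(ler_pM2l sum_dual_weights_gt0) sum_dual_weights.
rewrite -(weighted_pair_costs sw) mulr_suml; apply: ler_sum => a a0.
rewrite ler_pM2l ?p_gt0//; apply: char_obj_le_pair_cost => //.
  by case: sw.
exact: mix_mean_in.
Qed.

Lemma optimal_proportion_unique w : is_optimal_proportion d M mu c w ->
  w = w_of_y d mu c y.
Proof.
move=> [sw wopt]; have [w0 w1] := sw.
have yw : y / S <= char_obj d M mu c w.
  exact: le_trans le_char_obj_w_of_y (wopt _ simplex_w_of_y).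
have le_pair a : a != ord0 -> y / S <= pair_cost w a (m a).
  move=> a0; apply: (le_trans yw); apply: char_obj_le_pair_cost => //.
  exact: mix_mean_in.
(* The pair costs are at least y / S and their average with positive weights [p] equals y / S, so
   each is an equality. *)
have pairE a : a != ord0 -> pair_cost w a (m a) = y / S.
  move=> a0; apply/eqP; rewrite -subr_eq0.
  have : \sum_(b < n.+1 | b != ord0) p b * (pair_cost w b (m b) - y / S) = 0.
    under eq_bigr do rewrite mulrBr.
    by rewrite sumrB weighted_pair_costs// -mulr_suml sum_dual_weights subrr.
  move/psumr_eq0P => /(_ _ a a0)/eqP h.
  suff : p a * (pair_cost w a (m a) - y / S) == 0.
    by rewrite mulf_eq0 gt_eqF ?p_gt0.
  apply: h => b b0; rewrite mulr_ge0 ?subr_ge0 ?le_pair//.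
  exact/ltW/p_gt0.
pose u := w ord0 / c ord0.
have u0 : 0 <= u by rewrite divr_ge0// ltW.
have wE a : w a = c a * x a * u.
  have [->|a0] := eqVneq a ord0.
    by rewrite x_arm0 mulr1 /u mulrC divfK// gt_eqF.
  have v0 : 0 <= w a / c a by rewrite divr_ge0// ltW.
  (* By [pairE], [m a] attains the lower bound y / S on the pair costs, so it is the barycentre for
     the weights of [w]. It is also the one for weights 1 and [x a], which gives the ratio. *)
  have bal : u * (mu ord0 - m a) + w a / c a * (mu a - m a) = 0.
    apply: (weighted_mean_of_minimizer dM) => //; first exact: mix_mean_in.
    move=> z Mz; rewrite -/(pair_cost w a (m a)) pairE//.
    by apply: (le_trans yw); exact: char_obj_le_pair_cost.
  have e := mixture_balance (mu ord0) (mu a) (x_arm_ge0 a).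
  rewrite -[mixture _ _ _]/(m a) -/(x a) in e.
  have ma : m a - mu a != 0 by rewrite subr_eq0 gt_eqF// mix_mean_gt.
  have : (u * x a - w a / c a) * (m a - mu a) = 0.
    by rewrite -bal e; move: (m a) (x a) (w a / c a) => *; ring.
  move=> /eqP; rewrite mulf_eq0 (negbTE ma) orbF subr_eq0 => /eqP wa.
  by rewrite -mulrA [x a * u]mulrC wa mulrC divfK// gt_eqF.
have uE : u = S^-1.
  have : S * u = 1 by rewrite -w1 mulr_suml; apply: eq_bigr => a _; rewrite wE.
  by move/(canRL (mulKf (lt0r_neq0 normalization_gt0))); rewrite mulr1.
by apply/funext => a; rewrite wE uE.
Qed.

End at_level.

(** * Existence and uniqueness of the level *)

(** Both levels yield the same optimal proportion. Its entry at [ord0] determines the normalization,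
    then any other entry determines x_a, and g_a returns the level. *)
Lemma level_unique y y' : y_domain d mu y -> y_domain d mu y' ->
  F_fun d mu c y = 1 -> F_fun d mu c y' = 1 -> y' = y.
Proof.
move=> yD y'D F1 F1'.
have ww := optimal_proportion_unique yD F1 (w_of_y_optimal y'D F1').
have [a a0] := other_arm.
have := w_of_y_div (y := y) ord0; have := w_of_y_div (y := y) a.
rewrite -ww !w_of_y_div !x_arm0.
have := normalization_gt0 (y := y); have := normalization_gt0 (y := y').
move: (\sum_(b < n.+1) _) (\sum_(b < n.+1) _) => S' S S'0 S0 ea.
rewrite !mul1r => /invr_inj e; move: ea; rewrite e.
move/(mulIf (invr_neq0 (lt0r_neq0 S0))).
move=> xx; rewrite -(g_fun_x_arm yD a0) -(g_fun_x_arm y'D a0).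
by rewrite xx.
Qed.

Lemma y_domain_le y y' : 0 <= y -> y <= y' -> y_domain d mu y' -> y_domain d mu y.
Proof.
by move=> y0 yy' [_ y'D]; split => // a a0; apply: le_lt_trans yy' (y'D a a0).
Qed.

Lemma continuous_F_fun y : y_domain d mu y -> {for y, continuous (F_fun d mu c)}.
Proof.
move=> yD; apply: (cvg_big add_continuous) => a a0.
have cmix : mix_mean d mu a y' @[y' --> y] --> mix_mean d mu a y.
  apply: (@continuous_comp _ _ _ (x_arm d mu a) (mixture (mu ord0) (mu a))).
    rewrite /x_arm (negbTE a0); case: yD => y0 /(_ a a0) ya.
    by apply: (continuous_x_fun dM) => //; rewrite ?mu_lt ?y0.
  exact/continuous_mixture/x_arm_ge0.
have cd b : d (mu b) (mix_mean d mu a y') @[y' --> y] --> d (mu b) (mix_mean d mu a y).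
  apply: (@continuous_comp _ _ _ (mix_mean d mu a) (d (mu b))) => //.
  by apply: (bregman_continuous dM) => //; exact: mix_mean_in.
apply: cvgM; first by apply: cvgM; [exact: cvg_cst|exact: cd].
apply: cvgV; last by apply: cvgM; [exact: cvg_cst|exact: cd].
by rewrite mulf_neq0 ?gt_eqF// d_mix_mean_gt0.
Qed.

Lemma F_fun0 : F_fun d mu c 0 = 0.
Proof.
rewrite /F_fun big1// => a a0.
have D0 : 0 < d (mu ord0) (mu a).
  by apply: (bregman_gt0 dM) => //; rewrite gt_eqF// mu_lt.
have -> : mix_mean d mu a 0 = mu ord0; last by rewrite (bregman_id dM)// mulr0 mul0r.
(* Writing level 0 as g_a(0) lets [g_funK] compute x_a(0) = 0. *)
rewrite /mix_mean /x_arm (negbTE a0) -(g_fun0 dM (mu a) (mu_in ord0)).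
by rewrite (g_funK dM) ?mu_lt// mul0r !addr0 divr1.
Qed.

(** Take the arm a with least d(mu_1, mu_a), so that every value of g_a is in the domain of all
    arms. As its mixture tends to mu_a, d(mu_a, .) tends to 0 while d(mu_1, .) stays away from 0, so
    the term of a alone passes 1. *)
Lemma level_above_one : exists2 y, y_domain d mu y & 1 <= F_fun d mu c y.
Proof.
have [a1 a10] := other_arm.
have [a a0 amin] :=
  @arg_minP _ _ _ a1 (fun b => b != ord0) (fun b => d (mu ord0) (mu b)) a10.
have D0 : 0 < d (mu ord0) (mu a).
  by apply: (bregman_gt0 dM) => //; rewrite gt_eqF// mu_lt.
(* [h z > 0] means that the term of arm [a] exceeds 1 when its mixture is [z]; written as a
   difference it is continuous at [mu a]. *)
pose h z := c a * d (mu ord0) z - c ord0 * d (mu a) z.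
have ch : h z @[z --> (mu a)^'+] --> h (mu a).
  apply: cvg_at_right_filter; apply: cvgB;
    (apply: cvgM; [exact: cvg_cst|exact: (bregman_continuous dM)]).
have h0 : 0 < h (mu a) by rewrite /h (bregman_id dM)// mulr0 subr0 mulr_gt0.
near (mu a)^'+ => z.
have hz : 0 < h z by near: z; exact: cvgr_gt h0.
have az : mu a < z by near: z; exact: nbhs_right_gt.
have z1 : z < mu ord0 by near: z; apply: nbhs_right_lt; exact: mu_lt.
have [|t t0 tz] := @mixture_surj _ (mu ord0) (mu a) z; first by rewrite az ltW.
pose y := g_fun d (mu ord0) (mu a) t.
have yD : y_domain d mu y.
  split; first by rewrite -(g_fun0 dM (mu a) (mu_in ord0)) (g_fun_le dM) ?mu_lt.
  move=> b b0; apply: lt_le_trans (amin _ b0).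
  by apply: (g_fun_lt_bound dM); rewrite ?mu_lt.
exists y => //.
have mz : mix_mean d mu a y = z.
  by rewrite /mix_mean /x_arm (negbTE a0) (g_funK dM) ?mu_lt.
rewrite /F_fun (bigD1 a)//= mz ler_wpDr//; last first.
  have dz := d_mix_mean_gt0 (y := y) a0; rewrite mz in dz.
  by rewrite ler_pdivlMr ?mulr_gt0// mul1r -subr_ge0 ltW.
apply: sumr_ge0 => b /andP[b0 _].
by rewrite divr_ge0// mulr_ge0 ?(ltW (c_gt0 _))// (bregman_ge0 dM)//; exact: mix_mean_in.
Unshelve. all: end_near. Qed.

Lemma level_exists : exists2 y, y_domain d mu y & F_fun d mu c y = 1.
Proof.
have [y1 y1D F1] := level_above_one; have [y10 _] := y1D.
have cF : {within `[0, y1], continuous (F_fun d mu c)}.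
  apply: continuous_in_subspaceT => y; rewrite inE/= in_itv/= => /andP[y0 yy1].
  exact/continuous_F_fun/(y_domain_le y0 yy1).
have F01 : Num.min (F_fun d mu c 0) (F_fun d mu c y1) <= 1 <=
    Num.max (F_fun d mu c 0) (F_fun d mu c y1).
  by rewrite F_fun0 ge_min le_max ler01 F1 orbT.
have [y] := IVT y10 cF F01; rewrite in_itv/= => /andP[y0 yy1] Fy.
by exists y => //; exact: y_domain_le yy1 y1D.
Qed.

End bandit.

(** * The mean parametrization and its Bregman structure *)

Section mean_parametrization.
Context {R : realType} {nu : {measure set (measurableTypeR R) -> \bar R}}.
Hypothesis nu_gt0 : forall x0 : R, (0 < nu (~` [set x0]))%E.
Let Theta := nat_param_space nu.
Let M := mean_space nu.
Let f := ef_mean nu.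
Let th := theta_of_mean nu.

Lemma theta_of_meanP m : M m -> Theta (th m) /\ f (th m) = m.
Proof.
by move=> [t tT ft]; rewrite /th /theta_of_mean; case: xgetP => [z _ //|/(_ t)[]].
Qed.

Lemma ef_mean_le t s : Theta t -> Theta s -> t <= s -> f t <= f s.
Proof.
move=> tT sT; rewrite le_eqVlt => /predU1P[->//|ts].
exact: ltW (ef_mean_lt nu_gt0 tT sT ts).
Qed.

Lemma theta_of_mean_lt x t : M x -> Theta t -> x < f t -> th x < t.
Proof.
move=> Mx tT xt; have [xT xE] := theta_of_meanP Mx.
rewrite ltNge; apply/negP => /(ef_mean_le tT xT).
by rewrite xE leNgt xt.
Qed.

Lemma theta_of_mean_gt x t : M x -> Theta t -> f t < x -> t < th x.
Proof.
move=> Mx tT xt; have [xT xE] := theta_of_meanP Mx.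
rewrite ltNge; apply/negP => /(ef_mean_le xT tT).
by rewrite xE leNgt xt.
Qed.

Lemma theta_of_mean_le x y : M x -> M y -> x <= y -> th x <= th y.
Proof.
move=> Mx My; rewrite le_eqVlt => /predU1P[->//|xy].
have [yT yE] := theta_of_meanP My; apply/ltW/theta_of_mean_lt => //.
by rewrite yE.
Qed.

Lemma mean_between t s m : Theta t -> Theta s -> t <= s -> f t <= m <= f s -> M m.
Proof.
move=> tT sT ts mts.
have sub r : r \in `[t, s] -> Theta r.
  by rewrite in_itv/=; exact: is_interval_nat_param.
have cf : {within `[t, s], continuous f}.
  apply: continuous_in_subspaceT => r; rewrite inE/= => rts.
  exact/(continuous_ef_mean nu_gt0)/sub.
have fts : f t <= f s by exact: ef_mean_le.
have [|r rts <-] := IVT ts cf (v := m); first by rewrite (min_idPl fts) (max_idPr fts).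
by exists r => //; exact: sub.
Qed.

Lemma is_interval_mean_space : is_interval M.
Proof.
move=> x y Mx My m xmy.
have [xT xE] := theta_of_meanP Mx; have [yT yE] := theta_of_meanP My.
have xy : x <= y by have /andP[h1 h2] := xmy; exact: le_trans h1 h2.
apply: (mean_between xT yT); first exact: theta_of_mean_le.
by rewrite xE yE.
Qed.

(** Bracketing [m] by means of parameters close to [th m] gives both the openness of [M] and the
    continuity of [th]. *)
Lemma mean_space_nbhs m (e : R) : M m -> 0 < e -> exists t s,
  [/\ [/\ Theta t, Theta s & t <= s], f t < m < f s, th m - e <= t & s <= th m + e].
Proof.
move=> Mm e0; have [mT mE] := theta_of_meanP Mm.
have [e' e'0 sub] := nat_param_ball mT.
pose r := Num.min e e'; have r0 : 0 < r by rewrite lt_min e0.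
have re : r <= e by rewrite ge_min lexx.
have re' : r <= e' by rewrite ge_min lexx orbT.
have T1 : Theta (th m - r).
  by apply: sub; rewrite addrAC subrr sub0r normrN gtr0_norm.
have T2 : Theta (th m + r).
  by apply: sub; rewrite addrAC subrr add0r gtr0_norm.
exists (th m - r), (th m + r); split.
- by split => //; rewrite (@le_trans _ _ (th m)) ?lerDl ?lerBlDr ?lerDl// ltW.
- rewrite -[X in _ < X < _]mE; apply/andP; split;
    apply: (ef_mean_lt nu_gt0) => //; first by rewrite ltrBlDr ltrDl.
  by rewrite ltrDl.
- by rewrite lerB.
- by rewrite lerD2l.
Qed.

Lemma open_mean_space : open M.
Proof.
rewrite openE => m Mm; have [t [s [[tT sT ts] /andP[tm ms] _ _]]] :=
  mean_space_nbhs Mm ltr01.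
near=> x; apply: (mean_between tT sT ts).
by apply/andP; split; apply/ltW; near: x; [exact: lt_nbhsr|exact: lt_nbhsl].
Unshelve. all: end_near. Qed.

Lemma continuous_theta_of_mean m : M m -> {for m, continuous th}.
Proof.
move=> Mm; apply/cvgrPdist_le => e e0.
have [t [s [[tT sT ts] /andP[tm ms] te se]]] := mean_space_nbhs Mm e0.
near=> x.
have tx : f t < x by near: x; exact: lt_nbhsr.
have xs : x < f s by near: x; exact: lt_nbhsl.
have Mx : M x by apply: (mean_between tT sT ts); rewrite !ltW.
have h1 := theta_of_mean_lt Mx sT xs; have h2 := theta_of_mean_gt Mx tT tx.
rewrite distrC ler_distl; apply/andP; split.
  exact: le_trans te (ltW h2).
exact: le_trans (ltW h1) se.
Unshelve. all: end_near. Qed.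

Lemma kl_meanE x y : M x -> M y -> kl_mean nu x y =
  log_partition nu (th y) - log_partition nu (th x) - (th y - th x) * x.
Proof.
move=> Mx My; have [xT xE] := theta_of_meanP Mx; have [yT _] := theta_of_meanP My.
by rewrite /kl_mean (ef_KLE nu_gt0 xT yT); congr (_ - _ * _); exact: xE.
Qed.

(** Positivity is the strict tangent inequality of the log-partition function, and the three-point
    identity is algebra on [kl_meanE]. *)
Lemma kl_mean_bregman : bregman_divergence (kl_mean nu) M th.
Proof.
split.
- exact: open_mean_space.
- exact: is_interval_mean_space.
- by move=> x Mx; rewrite kl_meanE// !subrr mul0r subrr.
- move=> x y Mx My xy; rewrite kl_meanE// subr_gt0.
  have [xT xE] := theta_of_meanP Mx; have [yT yE] := theta_of_meanP My.
  have thxy : th y != th x.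
    by apply: contra_neq xy => e; rewrite -xE -yE e.
  by have := log_partition_tangent nu_gt0 xT yT thxy; rewrite -/f xE.
- exact: theta_of_mean_le.
- move=> x y z Mx My Mz; rewrite !kl_meanE//.
  by move: (log_partition nu _) (log_partition nu _) (log_partition nu _) => *; ring.
- move=> x y Mx My.
  have [yT _] := theta_of_meanP My.
  have near_M : \forall z \near y, M z := open_nbhs_nbhs (conj open_mean_space My).
  rewrite /prop_for /continuous_at kl_meanE//.
  apply: (@cvg_trans _ ((fun z => log_partition nu (th z) - log_partition nu (th x)
    - (th z - th x) * x) @ y)).
    by apply: near_eq_cvg; near=> z; rewrite kl_meanE//; near: z.
  have cth := continuous_theta_of_mean My.
  have cA : log_partition nu (th z) @[z --> y] --> log_partition nu (th y).
    exact: (continuous_comp cth (continuous_log_partition nu_gt0 yT)).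
  exact: (cvgB (cvgB cA (cvg_cst _)) (cvgM (cvgB cth (cvg_cst _)) (cvg_cst _))).
Unshelve. all: end_near. Qed.

End mean_parametrization.

Theorem theorem4 (R : realType) (nu : {measure set (measurableTypeR R) -> \bar R})
    (n : nat) (mu c : 'I_n.+1 -> R) :
    (* non-degenerate natural exponential family *)
    nat_param_space nu !=set0 ->
    (forall x0 : R, (0 < nu (~` [set x0]))%E) ->
    (0 < n)%N ->
    (forall a, mean_space nu (mu a)) ->
    (forall a : 'I_n.+1, a != ord0 -> mu a < mu ord0) ->
    (forall a, 0 < c a) ->
    let d := kl_mean nu in
    (exists y, y_domain d mu y /\ F_fun d mu c y = 1 /\
       forall y', y_domain d mu y' -> F_fun d mu c y' = 1 -> y' = y) /\
    (forall y, y_domain d mu y -> F_fun d mu c y = 1 ->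
       is_optimal_proportion d (mean_space nu) mu c (w_of_y d mu c y) /\
       forall w, is_optimal_proportion d (mean_space nu) mu c w ->
         w = w_of_y d mu c y).
Proof.
move=> _ nu_gt0 n_gt0 mu_in mu_lt c_gt0 d.
have dM := kl_mean_bregman nu_gt0; split.
  have [y yD Fy] := level_exists dM n_gt0 mu_in mu_lt c_gt0.
  exists y; split => //; split => // y' y'D Fy'.
  exact: (level_unique dM n_gt0 mu_in mu_lt c_gt0).
move=> y yD Fy; split; first exact: (w_of_y_optimal dM).
exact: (optimal_proportion_unique dM).
Qed.
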